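(* Every output $(Q,c)$ of Algorithm 2 (described in the context) satisfies $(Q,c)\notin\mathcal{E}_R$, i.e., $\ell^*_R\neq\ell^*$ for this instance.
   Context: Let $n \ge 1$, let $\mathcal{S}^n$ be the space of real symmetric $n\times n$ matrices, $e \in \mathbb{R}^n$ the all-ones vector, $\langle A,B\rangle = \mathrm{trace}(A^TB)$; inequalities on vectors and matrices are componentwise. For index sets $\mathbb{J},\mathbb{K}$, $x_{\mathbb{K}}$ is the subvector of $x$ indexed by $\mathbb{K}$ and $B_{\mathbb{J}\mathbb{K}}$ the submatrix of $B$ with rows in $\mathbb{J}$ and columns in $\mathbb{K}$. For $(Q,c) \in \mathcal{S}^n\times\mathbb{R}^n$ let $q(x) = \frac12 x^TQx + c^Tx$, $F = \{x \in \mathbb{R}^n : 0 \le x \le e\}$, and $\ell^* = \min_{x\in F} q(x)$ (the problem (BoxQP)). Let $$\mathcal{F}_R = \{(x,X)\in\mathbb{R}^n\times\mathcal{S}^n : 0\le x\le e,\ \max\{x_i+x_j-1,0\}\le X_{ij}\le \min\{x_i,x_j\},\ 1\le i\le j\le n\},$$ $\ell^*_R = \min\{\frac12\langle Q,X\rangle + c^Tx : (x,X)\in\mathcal{F}_R\}$ (the RLT relaxation), and $\mathcal{E}_R = \{(Q,c)\in\mathcal{S}^n\times\mathbb{R}^n : \ell^*=\ell^*_R\}$. Algorithm 2. Input: $n$ and $\mathbb{B}\subseteq\{1,\dots,n\}$ with $\mathbb{B}\ne\emptyset$. Choose an arbitrary $\mathbb{L}\subseteq\{1,\dots,n\}\setminus\mathbb{B}$,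 set $\mathbb{U}=\{1,\dots,n\}\setminus(\mathbb{B}\cup\mathbb{L})$, and choose an arbitrary $k\in\mathbb{B}$. Choose arbitrary: $\hat u\in\mathbb{R}^n$ with $\hat u_{\mathbb{U}}\ge0$, $\hat u_{\mathbb{L}\cup\mathbb{B}}=0$; $\hat v\in\mathbb{R}^n$ with $\hat v_{\mathbb{L}}\ge0$, $\hat v_{\mathbb{B}\cup\mathbb{U}}=0$; $\hat W\in\mathcal{S}^n$ with $\hat W_{\mathbb{L}\mathbb{L}}=0$, $\hat W_{\mathbb{L}\mathbb{B}}=0$, $\hat W_{\mathbb{B}\mathbb{L}}=0$, $\hat W_{kk}>0$, and $\hat W_{ij}\ge0$ otherwise; $\hat Y\in\mathbb{R}^{n\times n}$ with $\hat Y_{\mathbb{L}\mathbb{B}}=0$, $\hat Y_{\mathbb{L}\mathbb{U}}=0$, $\hat Y_{\mathbb{B}\mathbb{B}}=0$, $\hat Y_{\mathbb{B}\mathbb{U}}=0$, and $\hat Y_{ij}\ge0$ otherwise; $\hat Z\in\mathcal{S}^n$ with $\hat Z_{\mathbb{B}\mathbb{U}}=0$, $\hat Z_{\mathbb{U}\mathbb{B}}=0$, $\hat Z_{\mathbb{U}\mathbb{U}}=0$, $\hat Z_{kk}>0$, and $\hat Z_{ij}\ge0$ otherwise. Output $(Q,c)$ with $Q=\hat W-\hat Y-\hat Y^T+\hat Z$ and $c=-\hat u+\hat v-\hat We+\hat Y^Te$. *)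

(* Defs.v *)
From mathcomp Require Import all_boot all_order all_algebra.
From mathcomp Require Import boolp classical_sets reals.

Set Implicit Arguments.
Unset Strict Implicit.
Unset Printing Implicit Defensive.

Import Order.TTheory GRing.Theory Num.Theory.
Local Open Scope ring_scope.
Local Open Scope classical_set_scope.

Definition symmetric_mx (R : realType) (n : nat) (A : 'M[R]_n) : Prop :=
  A^T = A.

Definition ones (R : realType) (n : nat) : 'cV[R]_n := const_mx 1.

Definition frob (R : realType) (n : nat) (A B : 'M[R]_n) : R := \tr (A^T *m B).

Definition dotv (R : realType) (n : nat) (x y : 'cV[R]_n) : R :=
  (x^T *m y) 0 0.

Definition quad (R : realType) (n : nat) (Q : 'M[R]_n) (c x : 'cV[R]_n) : R :=
  2^-1 * dotv x (Q *m x) + dotv c x.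

Definition box (R : realType) (n : nat) : set 'cV[R]_n :=
  [set x | forall i, 0 <= x i 0 <= 1].

(* The box is nonempty and compact and [quad Q c] is continuous, so this
   infimum is the minimum; likewise for [ell_RLT] below. *)
Definition ell (R : realType) (n : nat) (Q : 'M[R]_n) (c : 'cV[R]_n) : R :=
  inf [set quad Q c x | x in @box R n].

Definition RLT (R : realType) (n : nat) : set ('cV[R]_n * 'M[R]_n) :=
  [set xX | [/\ box xX.1, symmetric_mx xX.2 &
     forall i j : 'I_n, (i <= j)%N ->
       Num.max (xX.1 i 0 + xX.1 j 0 - 1) 0 <= xX.2 i j
         <= Num.min (xX.1 i 0) (xX.1 j 0)]].

Definition ell_RLT (R : realType) (n : nat) (Q : 'M[R]_n) (c : 'cV[R]_n) : R :=
  inf [set 2^-1 * frob Q xX.2 + dotv c xX.1 | xX in @RLT R n].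

Definition exact_RLT (R : realType) (n : nat) : set ('M[R]_n * 'cV[R]_n) :=
  [set Qc | symmetric_mx Qc.1 /\ ell Qc.1 Qc.2 = ell_RLT Qc.1 Qc.2].

Definition zero_block (R : realType) (n : nat) (A : 'M[R]_n)
    (J K : {set 'I_n}) : Prop :=
  forall i j, i \in J -> j \in K -> A i j = 0.

(* [algorithm2_output B Q c]: some run of the algorithm on input [n], [B]
   returns [(Q, c)].  Entrywise nonnegativity of [W], [Y], [Z] is imposed
   everywhere, which the zero blocks satisfy trivially. *)
Inductive algorithm2_output (R : realType) (n : nat) (B : {set 'I_n}) :
    'M[R]_n -> 'cV[R]_n -> Prop :=
  Algorithm2Output (L U : {set 'I_n}) (k : 'I_n)
      (u v : 'cV[R]_n) (W Y Z : 'M[R]_n) of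
      L \subset ~: B & U = ~: (B :|: L) & k \in B
    & (forall i, i \in U -> 0 <= u i 0)
    & (forall i, i \in L :|: B -> u i 0 = 0)
    & (forall i, i \in L -> 0 <= v i 0)
    & (forall i, i \in B :|: U -> v i 0 = 0)
    & symmetric_mx W
    & zero_block W L L & zero_block W L B & zero_block W B L
    & 0 < W k k & (forall i j, 0 <= W i j)
    & zero_block Y L B & zero_block Y L U
    & zero_block Y B B & zero_block Y B U
    & (forall i j, 0 <= Y i j)
    & symmetric_mx Z
    & zero_block Z B U & zero_block Z U B & zero_block Z U U
    & 0 < Z k k & (forall i j, 0 <= Z i j) :
  algorithm2_output B (W - Y - Y^T + Z)
    (- u + v - W *m ones R n + Y^T *m ones R n).

(* Main.v *)
Require Import Defs.
From mathcomp Require Import all_boot all_order all_algebra.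
From mathcomp Require Import boolp classical_sets reals.
From mathcomp Require Import ring lra.

Set Implicit Arguments.
Unset Strict Implicit.

Import Order.TTheory GRing.Theory Num.Theory.
Local Open Scope ring_scope.

(** The matrices chosen by the algorithm are multipliers of a dual solution of
    the linear relaxation.  For symmetric [W] and [X], the relaxed objective is
    a constant [dual_value u W] plus [dual_slack u v W Y Z x X], a combination
    of the slacks of the RLT constraints in which every coefficient is
    nonnegative ([rlt_objE]).  Both parts of the argument read off this
    identity.

    The relaxation attains the constant: the zero blocks are exactly the
    complementary slackness conditions for the point with [x = 0] on [L],
    [x = 1/2] on [B], [x = 1] on [U] and [X i j = max (x i + x j - 1) 0]
    ([dual_slack_witness]), so [ell_RLT Q c <= dual_value u W].

    The nonconvex problem stays away from the constant: for [X = x x^T] the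
    slacks factor into products such as [(1 - x i) * (1 - x j)], all
    nonnegative on the box, and the two diagonal terms at [k] contribute
    [(W k k * (1 - x k)^2 + Z k k * (x k)^2) / 2], which cannot be small since
    [x k] is not close to [0] and [1] at once ([dual_slack_rank1]).  Hence the
    gap [ell Q c - ell_RLT Q c] is at least [min (W k k) (Z k k) / 4 > 0]. *)

(** * Double sums of nonnegative terms *)

Section SumBounds.
Variable R : realType.

Lemma sum2_ge0 (n : nat) (F : 'I_n -> 'I_n -> R) :
  (forall i j, 0 <= F i j) -> 0 <= \sum_i \sum_j F i j.
Proof. by move=> F0; apply: sumr_ge0 => i _; apply: sumr_ge0. Qed.

Lemma sum2_ge_entry (n : nat) (F : 'I_n -> 'I_n -> R) (k l : 'I_n) :
  (forall i j, 0 <= F i j) -> F k l <= \sum_i \sum_j F i j.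
Proof.
move=> F0; rewrite (bigD1 k) //= (bigD1 l) //= -addrA lerDl addr_ge0 //.
  by apply: sumr_ge0.
by apply: sumr_ge0 => i _; apply: sumr_ge0.
Qed.

End SumBounds.

(** * The relaxed objective and its dual decomposition *)

Section Objective.
Variables (R : realType) (n : nat).
Implicit Types (x u v c : 'cV[R]_n) (A Q W X Y Z : 'M[R]_n).

Definition rlt_obj Q c x X : R := 2^-1 * frob Q X + dotv c x.

Lemma dotvE u x : dotv u x = \sum_i u i 0 * x i 0.
Proof. by rewrite /dotv mxE; apply: eq_bigr => i _; rewrite mxE. Qed.

Lemma frobE A X : frob A X = \sum_i \sum_j A i j * X i j.
Proof.
rewrite /frob /mxtrace exchange_big; apply: eq_bigr => j _; rewrite mxE.
by apply: eq_bigr => i _; rewrite mxE.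
Qed.

Lemma frob_tr A X : symmetric_mx X -> frob A^T X = frob A X.
Proof. by move=> sX; rewrite /frob -{1}sX -trmx_mul mxtrace_tr mxtrace_mulC. Qed.

Lemma dotv_mul_ones A x :
  dotv (A *m ones R n) x = \sum_i \sum_j A i j * x i 0.
Proof.
rewrite dotvE; apply: eq_bigr => i _; rewrite mxE mulr_suml.
by apply: eq_bigr => j _; rewrite mxE mulr1.
Qed.

Lemma dotv_tr_mul_ones A x :
  dotv (A^T *m ones R n) x = \sum_i \sum_j A i j * x j 0.
Proof.
rewrite dotv_mul_ones exchange_big; apply: eq_bigr => i _.
by apply: eq_bigr => j _; rewrite mxE.
Qed.

Lemma symmetric_rank1 x : symmetric_mx (x *m x^T).
Proof. by rewrite /symmetric_mx trmx_mul trmxK. Qed.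

Lemma quad_rank1 Q c x :
  symmetric_mx Q -> quad Q c x = rlt_obj Q c x (x *m x^T).
Proof.
move=> sQ; rewrite /quad /rlt_obj /dotv /frob sQ.
by rewrite mxtrace_mulC -mulmxA mxtrace_mulC -mulmxA /mxtrace big_ord1.
Qed.

Definition dual_value u W : R :=
  - (2^-1 * \sum_i \sum_j W i j) - \sum_i u i 0.

Definition dual_slack u v W Y Z x X : R :=
  2^-1 * (\sum_i \sum_j W i j * (X i j - x i 0 - x j 0 + 1))
  + \sum_i \sum_j Y i j * (x j 0 - X i j)
  + 2^-1 * (\sum_i \sum_j Z i j * X i j)
  + \sum_i u i 0 * (1 - x i 0) + \sum_i v i 0 * x i 0.

(** Every slack [a - b] of a constraint is multiplied out: the parts that are
    linear in [(x, X)] reproduce [Q] and [c], which the algorithm defines to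
    that end, and the constants [1] collect into [dual_value]. *)
Lemma rlt_objE u v W Y Z x X : symmetric_mx W -> symmetric_mx X ->
  rlt_obj (W - Y - Y^T + Z) (- u + v - W *m ones R n + Y^T *m ones R n) x X
  = dual_value u W + dual_slack u v W Y Z x X.
Proof.
move=> sW sX; rewrite /rlt_obj.
have frobDN : frob (W - Y - Y^T + Z) X
    = frob W X - frob Y X - frob Y^T X + frob Z X.
  by rewrite /frob !linearD /= !linearN /= !mulmxDl !mulNmx !linearD /= !linearN.
have dotvDN : dotv (- u + v - W *m ones R n + Y^T *m ones R n) x
    = - dotv u x + dotv v x - dotv (W *m ones R n) x + dotv (Y^T *m ones R n) x.
  rewrite !dotvE -!sumrN -!big_split; apply: eq_bigr => i _ /=.
  by rewrite 4!mxE [(- (W *m _)) i 0]mxE !mulrDl !mulNr.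
rewrite frobDN frob_tr // dotvDN dotv_tr_mul_ones /dual_value /dual_slack.
have sumW : \sum_i \sum_j W i j * (X i j - x i 0 - x j 0 + 1)
    = frob W X - dotv (W *m ones R n) x *+ 2 + \sum_i \sum_j W i j.
  (* symmetry of [W] makes the row weights and the column weights agree *)
  have := dotv_tr_mul_ones W x; rewrite sW => dotvW.
  rewrite mulr2n {1}dotvW dotv_mul_ones frobE opprD.
  rewrite -!sumrN -!big_split; apply: eq_bigr => i _ /=.
  by rewrite -!sumrN -!big_split; apply: eq_bigr => j _ /=; ring.
have sumY : \sum_i \sum_j Y i j * (x j 0 - X i j)
    = \sum_i \sum_j Y i j * x j 0 - frob Y X.
  rewrite frobE -sumrB; apply: eq_bigr => i _; rewrite -sumrB.
  by apply: eq_bigr => j _; ring.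
have sumu : \sum_i u i 0 * (1 - x i 0) = \sum_i u i 0 - dotv u x.
  by rewrite dotvE -sumrB; apply: eq_bigr => i _; ring.
rewrite sumW sumY sumu -frobE -dotvE.
lra.
Qed.

(** The constraints are imposed for [i <= j] only; the symmetry of [X] extends
    them to the pairs over which the double sums of [dual_slack] range. *)
Lemma RLT_bounds x X i j : RLT (x, X) ->
  [/\ 0 <= X i j, 0 <= X i j - x i 0 - x j 0 + 1 & 0 <= x j 0 - X i j].
Proof.
case=> /= _ sX bX.
wlog ij : i j / (i <= j)%N => [hw|].
  case/orP: (leq_total i j) => [/hw //|ij].
  have := bX _ _ ij; rewrite -{1 2}sX mxE ge_max le_min.
  by case/andP => /andP[? ?] /andP[? ?]; split; lra.
by have := bX _ _ ij; rewrite ge_max le_min;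
  case/andP => /andP[? ?] /andP[? ?]; split; lra.
Qed.

(** With [rlt_objE], this bounds the relaxed objective below on [RLT], so that
    its infimum lies below the value at any given feasible point. *)
Lemma dual_slack_ge0 u v W Y Z x X :
    (forall i, 0 <= u i 0) -> (forall i, 0 <= v i 0) ->
    (forall i j, 0 <= W i j) -> (forall i j, 0 <= Y i j) ->
    (forall i j, 0 <= Z i j) ->
  RLT (x, X) -> 0 <= dual_slack u v W Y Z x X.
Proof.
move=> u0 v0 W0 Y0 Z0 xX.
have bX i j := RLT_bounds i j xX.
have bx i : 0 <= x i 0 <= 1 by case: xX => /(_ i).
rewrite /dual_slack !addr_ge0 ?mulr_ge0 ?invr_ge0 ?sum2_ge0 //.
- by move=> i j; case: (bX i j) => *; apply: mulr_ge0.
- by move=> i j; case: (bX i j) => *; apply: mulr_ge0.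
- by move=> i j; case: (bX i j) => *; apply: mulr_ge0.
- by apply: sumr_ge0 => i _; case/andP: (bx i) => *; rewrite mulr_ge0 ?subr_ge0.
- by apply: sumr_ge0 => i _; case/andP: (bx i) => *; rewrite mulr_ge0.
Qed.

(** The diagonal terms at [k] alone keep the slack of a rank one point away
    from zero, as [(1 - t)^2 + t^2 >= 1/2] for every [t].  The bound is uniform
    in [x], so it passes to the infimum over the box without compactness. *)
Lemma dual_slack_rank1 u v W Y Z x (k : 'I_n) :
    (forall i, 0 <= u i 0) -> (forall i, 0 <= v i 0) ->
    (forall i j, 0 <= W i j) -> (forall i j, 0 <= Y i j) ->
    (forall i j, 0 <= Z i j) ->
  box x ->
  Num.min (W k k) (Z k k) / 4 <= dual_slack u v W Y Z x (x *m x^T).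
Proof.
move=> u0 v0 W0 Y0 Z0 bx.
have x0 i : 0 <= x i 0 by case/andP: (bx i).
have x1 i : 0 <= 1 - x i 0 by case/andP: (bx i); rewrite subr_ge0.
have xxE i j : (x *m x^T) i j = x i 0 * x j 0 by rewrite mxE big_ord1 mxE.
rewrite /dual_slack.
have bW : W k k * (1 - x k 0) ^+ 2
    <= \sum_i \sum_j W i j * ((x *m x^T) i j - x i 0 - x j 0 + 1).
  have -> : W k k * (1 - x k 0) ^+ 2
    = W k k * ((x *m x^T) k k - x k 0 - x k 0 + 1) by rewrite xxE; ring.
  apply: (@sum2_ge_entry R n (fun i j => W i j * _)) => i j.
  rewrite xxE (_ : _ + 1 = (1 - x i 0) * (1 - x j 0)); last by ring.
  by rewrite !mulr_ge0.
have bY : 0 <= \sum_i \sum_j Y i j * (x j 0 - (x *m x^T) i j).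
  apply: sum2_ge0 => i j.
  rewrite xxE (_ : _ - _ = (1 - x i 0) * x j 0); last by ring.
  by rewrite !mulr_ge0.
have bZ : Z k k * x k 0 ^+ 2 <= \sum_i \sum_j Z i j * (x *m x^T) i j.
  rewrite expr2 -xxE; apply: (@sum2_ge_entry R n (fun i j => Z i j * _)) => i j.
  by rewrite xxE !mulr_ge0.
have bu : 0 <= \sum_i u i 0 * (1 - x i 0).
  by apply: sumr_ge0 => i _; rewrite mulr_ge0.
have bv : 0 <= \sum_i v i 0 * x i 0.
  by apply: sumr_ge0 => i _; rewrite mulr_ge0.
set m := Num.min _ _.
have mW : m * (1 - x k 0) ^+ 2 <= W k k * (1 - x k 0) ^+ 2.
  by rewrite ler_wpM2r ?sqr_ge0 // ge_min lexx.
have mZ : m * x k 0 ^+ 2 <= Z k k * x k 0 ^+ 2.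
  by rewrite ler_wpM2r ?sqr_ge0 // ge_min lexx orbT.
have m0 : 0 <= m by rewrite le_min W0 Z0.
have mid : m / 2 <= m * (1 - x k 0) ^+ 2 + m * x k 0 ^+ 2.
  rewrite -mulrDr ler_wpM2l //.
  by have := sqr_ge0 (x k 0 - 2^-1); rewrite !expr2; lra.
lra.
Qed.

End Objective.

(** * A point of the relaxation with zero slack *)

Section Witness.
Variables (R : realType) (n : nat).

Definition witness_x (L B : {set 'I_n}) : 'cV[R]_n :=
  \col_i (if i \in L then 0 else if i \in B then 2^-1 else 1).

Definition witness_X (x : 'cV[R]_n) : 'M[R]_n :=
  \matrix_(i, j) Num.max (x i 0 + x j 0 - 1) 0.

Lemma witness_x_box L B : box (witness_x L B).
Proof. by move=> i; rewrite mxE; case: ifP => _; [|case: ifP => _]; lra. Qed.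

Lemma witness_RLT (x : 'cV[R]_n) : box x -> RLT (x, witness_X x).
Proof.
move=> bx; split => //=.
  by apply/matrixP => i j; rewrite !mxE [x j 0 + _]addrC.
move=> i j _; rewrite mxE lexx /= le_min !ge_max.
by case/andP: (bx i) => ? ?; case/andP: (bx j) => ? ?; apply/and3P; split;
  rewrite // -?andbA; try (apply/andP; split); lra.
Qed.

(** The zero blocks of the algorithm are the complementary slackness conditions
    for this point: wherever a multiplier may be positive, its constraint is
    tight.  Only the value [1/2] on [B] makes both bounds
    [X i j >= x i + x j - 1] and [X i j >= 0] tight on [B x B]. *)
Lemma dual_slack_witness (L B U : {set 'I_n}) (u v : 'cV[R]_n)
    (W Y Z : 'M[R]_n) (x := witness_x L B) :
    L \subset ~: B -> U = ~: (B :|: L) ->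
    (forall i, i \in L :|: B -> u i 0 = 0) ->
    (forall i, i \in B :|: U -> v i 0 = 0) ->
    zero_block W L L -> zero_block W L B -> zero_block W B L ->
    zero_block Y L B -> zero_block Y L U ->
    zero_block Y B B -> zero_block Y B U ->
    zero_block Z B U -> zero_block Z U B -> zero_block Z U U ->
  dual_slack u v W Y Z x (witness_X x) = 0.
Proof.
move=> LB defU u0 v0 WLL WLB WBL YLB YLU YBB YBU ZBU ZUB ZUU.
have part i : [\/ i \in L /\ x i 0 = 0, i \in B /\ x i 0 = 2^-1
                | i \in U /\ x i 0 = 1].
  rewrite defU !inE /x mxE; case: ifP => iL; first by apply: Or31.
  by case: ifP => iB; [apply: Or32 | apply: Or33].
have maxl (a : R) : 0 <= a -> Num.max a 0 = a by move=> /max_idPl.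
have maxr (a : R) : a <= 0 -> Num.max a 0 = 0 by move=> /max_idPr.
have XE i j : witness_X x i j = Num.max (x i 0 + x j 0 - 1) 0 by rewrite mxE.
have W_tight i j : W i j * (witness_X x i j - x i 0 - x j 0 + 1) = 0.
  rewrite XE; case: (part i) => -[iP xi]; case: (part j) => -[jP xj];
  by [rewrite WLL // mul0r | rewrite WLB // mul0r | rewrite WBL // mul0r
     | rewrite xi xj maxl; lra].
have Y_tight i j : Y i j * (x j 0 - witness_X x i j) = 0.
  rewrite XE; case: (part i) => -[iP xi]; case: (part j) => -[jP xj];
  by [rewrite YLB // mul0r | rewrite YLU // mul0r | rewrite YBB // mul0r
     | rewrite YBU // mul0r | rewrite xi xj maxl; lra
     | rewrite xi xj maxr; lra].
have Z_tight i j : Z i j * witness_X x i j = 0.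
  rewrite XE; case: (part i) => -[iP xi]; case: (part j) => -[jP xj];
  by [rewrite ZBU // mul0r | rewrite ZUB // mul0r | rewrite ZUU // mul0r
     | rewrite xi xj maxr; lra].
have u_tight i : u i 0 * (1 - x i 0) = 0.
  case: (part i) => -[iP xi]; last by rewrite xi subrr mulr0.
    by rewrite u0 ?mul0r // inE iP.
  by rewrite u0 ?mul0r // inE iP orbT.
have v_tight i : v i 0 * x i 0 = 0.
  case: (part i) => -[iP xi]; first by rewrite xi mulr0.
    by rewrite v0 ?mul0r // inE iP.
  by rewrite v0 ?mul0r // inE iP orbT.
rewrite /dual_slack [X in _ * X + _ + _ + _ + _]big1; last first.
  by move=> i _; rewrite big1.
rewrite [X in _ + X + _ + _ + _]big1; last by move=> i _; rewrite big1.
rewrite [X in _ + _ * X + _ + _]big1; last by move=> i _; rewrite big1.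
by rewrite !big1 // !mulr0 !addr0.
Qed.

End Witness.

(** * The relaxation gap *)

Lemma algorithm2_gap (R : realType) (n : nat) (B : {set 'I_n})
    (Q : 'M[R]_n) (c : 'cV[R]_n) :
  algorithm2_output B Q c -> ell_RLT Q c < ell Q c.
Proof.
case=> L U k u v W Y Z LB defU kB uU uLB vL vBU sW WLL WLB WBL Wkk W0
  YLB YLU YBB YBU Y0 sZ ZBU ZUB ZUU Zkk Z0.
have u0 i : 0 <= u i 0.
  case: (boolP (i \in U)) => [/uU // | iU]; rewrite uLB //.
  by move: iU; rewrite defU !inE negbK orbC.
have v0 i : 0 <= v i 0.
  case: (boolP (i \in L)) => [/vL // | iL]; rewrite vBU //.
  by rewrite defU !inE (negPf iL) orbF orbN.
set Q' := W - Y - Y^T + Z; set c' := - u + _ - _ + _.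
have sQ : symmetric_mx Q'.
  by rewrite /symmetric_mx !linearD /= !linearN /= trmxK sW sZ [W - Y^T - Y]addrAC.
pose g := dual_value u W; pose x := witness_x R L B.
have bx : box x by exact: witness_x_box.
have upper : ell_RLT Q' c' <= g.
  have -> : g = rlt_obj Q' c' x (witness_X x).
    have [_ sX _] := witness_RLT bx.
    by rewrite rlt_objE // (dual_slack_witness LB defU) ?addr0.
  apply: ge_inf; last by exists (x, witness_X x); first exact: witness_RLT.
  exists g => _ [[y X] yX <-]; have [_ sX _] := yX.
  rewrite -[leRHS]/(rlt_obj Q' c' y X) rlt_objE // lerDl.
  exact: dual_slack_ge0.
have lower : g + Num.min (W k k) (Z k k) / 4 <= ell Q' c'.
  apply: lb_le_inf; first by exists (quad Q' c' x), x.
  move=> _ [y by_ <-]; rewrite quad_rank1 // rlt_objE //; last first.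
    exact: symmetric_rank1.
  by rewrite lerD2l dual_slack_rank1.
apply: le_lt_trans upper (lt_le_trans _ lower).
by rewrite ltrDl divr_gt0 // lt_min Wkk Zkk.
Qed.

Theorem proposition4p5 (R : realType) (n : nat) (B : {set 'I_n})
    (Q : 'M[R]_n) (c : 'cV[R]_n) :
  (0 < n)%N -> B != finset.set0 -> algorithm2_output B Q c ->
  ~ exact_RLT (Q, c) /\ ell_RLT Q c <> ell Q c.
Proof.
move=> _ _ /algorithm2_gap gap; split=> [[_ /=] eq_ell | eq_ell].
  by rewrite eq_ell ltxx in gap.
by rewrite eq_ell ltxx in gap.
Qed.
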